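(* Let $S\in\mathsf{SS}^{\mathrm{ns}}_{\leq n}$. Suppose that for every vertex $v\in S_0$ we are given a finite-dimensional $\Bbbk$-vector space $E_v$, and for every $e\in S_1$ an isomorphism $R_e\colon E_{d_1(e)}\to E_{d_0(e)}$. For $\sigma=[v_0,v_1,v_2]\in S_2$ write $R_{01}^\sigma:=R_{d_2\sigma}$, $R_{02}^\sigma:=R_{d_1\sigma}$, $R_{12}^\sigma:=R_{d_0\sigma}$. The following are equivalent: (i) For every $\sigma=[v_0,v_1,v_2]\in S_2$, $R_{02}^\sigma=R_{12}^\sigma R_{01}^\sigma$. (ii) The left connection on $M^0:=\bigoplus_{v\in S_0}E_v$ with edge transports $\{R_e\}_{e\in S_1}$ has curvature zero on every $2$-simplex. (iii) The vertex spaces and edge transports extend to a connection sheaf $F\colon P_S\to\mathrm{Vect}_\Bbbk$ such that $F(v)=E_v$ for every $v\in S_0$ and, for every $e\in S_1$, $R_e=F(d_0(e)\le e)^{-1}\circ F(d_1(e)\le e)$. Moreover, such an extension is unique up to cellular gauge.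
   Context: $\Bbbk$ is a field of characteristic different from $2$. $\mathsf{SS}^{\mathrm{ns}}_{\leq n}$ is the category of $n$-truncated semisimplicial sets $S$ with finitely many simplices such that every simplex is determined by its ordered tuple of vertices and every positive-dimensional simplex has pairwise distinct vertices. $[v_0,\dots,v_p]$ is the simplex with ordered vertices $v_0,\dots,v_p$; $d_j$ deletes $v_j$; an edge $e$ goes from $d_1(e)$ to $d_0(e)$. $P_S=\bigsqcup_pS_p$ is the face poset ($\sigma\le\tau$ iff $\sigma$ is an iterated face of $\tau$). $\mathrm{Vect}_\Bbbk$ is the category of finite-dimensional vector spaces. A *connection sheaf* on $S$ is a functor $F\colon P_S\to\mathrm{Vect}_\Bbbk$ such that $F(\sigma\le\tau)$ is an isomorphism for all $\sigma\le\tau$. If $F,F'$ are connection sheaves with $F(v)=F'(v)=E_v$ for all $v\in S_0$, a *cellular gauge* from $F$ to $F'$ is a natural isomorphism $h\colon F\Rightarrow F'$ with $h_v=\mathrm{id}_{E_v}$ for all $v\in S_0$. **Connections and curvature.** $\Omega_S^\bullet$ is the DGA with $\Omega_S^p$ having basis $\{\rho_\sigma\}_{\sigma\in S_p}$; $\Omega_S^0=A_S=\Bbbk(S_0)$ with $\rho_{[v]}=\delta_v$ the indicator idempotents; $\omega_e:=\rho_e$; $\rho_{[v_0,\dots,v_p]}\wedge\rho_{[w_0,\dots,w_q]}=\rho_{[v_0,\dots,v_p,w_1,\dots,w_q]}$ if $v_p=w_0$ and the latter tuple is a simplex of $S$, and $0$ otherwise; $d\rho_\sigma=\sum_{j}(-1)^j\sum_{\tau\in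 S_{p+1},d_j\tau=\sigma}\rho_\tau$. The space $M=M^0=\bigoplus_vE_v$ is a left $A_S$-module with $\delta_v$ acting as projection onto $E_v$. The left connection with edge transports $R_e$ is $\nabla(x)=\sum_{e\in S_1}\omega_e\otimes(\delta_{d_0(e)}x-R_e(\delta_{d_1(e)}x))\in\Omega_S^1\otimes_{A_S}M$. It extends to $\widehat\nabla(\alpha\otimes x)=d\alpha\otimes x+(-1)^{|\alpha|}\alpha\wedge\nabla(x)$ on $\Omega_S^\bullet\otimes_{A_S}M$; the curvature is $K_\nabla=\widehat\nabla^2|_M\colon M\to\Omega_S^2\otimes_{A_S}M$, which can be written uniquely as $K_\nabla(x)=\sum_{\sigma=[v_0,v_1,v_2]\in S_2}\rho_\sigma\otimes(K_\nabla)_\sigma(\delta_{v_0}x)$ with linear maps $(K_\nabla)_\sigma\colon E_{v_0}\to E_{v_2}$. Curvature zero on $\sigma$ means $(K_\nabla)_\sigma=0$. *)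

(* Defs.v *)
From HB Require Import structures.
From mathcomp Require Import freeg.
From mathcomp Require Import all_boot all_order all_algebra.
From mathcomp Require Import boolp.

Set Implicit Arguments.
Unset Strict Implicit.
Unset Printing Implicit Defensive.

Import Order.TTheory GRing.Theory.
Local Open Scope ring_scope.

(* An n-truncated semisimplicial set is encoded as a graded family that is
   empty above degree n.  The semisimplicial identity d_i d_(j+1) = d_j d_i
   (i <= j) is stated with [lift ord0 j], whose value is j + 1, and
   [widen_ord], which keeps the value i. *)
Record semisimplicial (n : nat) := Semisimplicial {
  simplices :> nat -> finType;
  face : forall p : nat, 'I_p.+2 -> simplices p.+1 -> simplices p;
  face_face : forall (p : nat) (i j : 'I_p.+2) (s : simplices p.+2), (i <= j)%N ->
    face i (face (lift ord0 j) s) = face j (face (widen_ord (leqnSn _) i) s);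
  truncated : forall p : nat, (n < p)%N -> #|simplices p| = 0%N }.

Arguments face {n} _ {p} _ _.

Notation "'d_0'" := (@face _ _ _ (@Ordinal _.+2 0 isT)) (at level 0).
Notation "'d_1'" := (@face _ _ _ (@Ordinal _.+2 1 isT)) (at level 0).
Notation "'d_2'" := (@face _ _ _ (@Ordinal _.+3 2 isT)) (at level 0).

Section Vertices.
Context {n : nat} {S : semisimplicial n}.

Fixpoint first_vertex (p : nat) : S p -> S 0 :=
  match p with
  | 0 => id
  | _.+1 => fun s => first_vertex (face S ord_max s)
  end.

Fixpoint last_vertex (p : nat) : S p -> S 0 :=
  match p with
  | 0 => id
  | _.+1 => fun s => last_vertex (face S ord0 s)
  end.

Fixpoint vertices (p : nat) : S p -> seq (S 0) :=
  match p with
  | 0 => fun v => [:: v]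
  | _.+1 => fun s => first_vertex s :: vertices (face S ord0 s)
  end.

End Vertices.

(* The objects of SS^ns_{<= n}; finiteness comes from [finType] and [truncated]. *)
Record nonsingular (n : nat) (S : semisimplicial n) : Prop := {
  vertices_determine : forall p : nat, injective (@vertices n S p);
  vertices_distinct : forall (p : nat) (s : S p.+1), uniq (vertices s) }.

Definition face_poset (n : nat) (S : semisimplicial n) : Type := {p : nat & S p}.

Section FacePoset.
Context {n : nat} {S : semisimplicial n}.

HB.instance Definition _ := Choice.on (face_poset S).

Definition simp (p : nat) (s : S p) : face_poset S := existT _ p s.

Fixpoint is_face (x : face_poset S) (q : nat) : S q -> bool :=
  match q with
  | 0 => fun t => x == simp t
  | _.+1 => fun t => (x == simp t) || [exists j, is_face x (face S j t)]
  end.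

Definition face_le (x y : face_poset S) : bool := is_face x (tagged y).

Lemma is_face_refl q (t : S q) : is_face (simp t) t.
Proof. by case: q t => [|q] t /=; rewrite eqxx. Qed.

Lemma is_faceS x q j (t : S q.+1) : is_face x (face S j t) -> is_face x t.
Proof. by move=> h /=; apply/orP; right; apply/existsP; exists j. Qed.

Lemma is_face_dim x q (t : S q) : is_face x t -> (tag x <= q)%N.
Proof.
elim: q t => [|q IHq] t /=; first by move/eqP=> ->.
by case/orP=> [/eqP-> //|/existsP[j /IHq]]; apply: leqW.
Qed.

Fact face_le_refl : reflexive face_le.
Proof. by case=> q t; apply: is_face_refl. Qed.

Fact face_le_anti : antisymmetric face_le.
Proof.
case=> p s [q t] /andP[]; rewrite /face_le /= => hst /is_face_dim /=.
case: q t hst => [|q] t /=; first by move/eqP.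
case/orP=> [/eqP-> //|/existsP[j /is_face_dim /= pq] qp].
by have := leq_trans qp pq; rewrite ltnn.
Qed.

Fact face_le_trans : transitive face_le.
Proof.
move=> y x [q t] xy; rewrite /face_le /=.
elim: q t => [|q IHq] t /=; first by move/eqP=> yt; move: xy; rewrite yt.
by case/orP=> [/eqP yt|/existsP[j /IHq /is_faceS //]]; move: xy; rewrite yt.
Qed.

Fact face_poset_display : Order.disp_t. Proof. exact: Order.Disp tt tt. Qed.

HB.instance Definition _ := Order.Le_isPOrder.Build face_poset_display
  (face_poset S) face_le_refl face_le_anti face_le_trans.

Lemma le_face p (j : 'I_p.+2) (s : S p.+1) : (simp (face S j s) <= simp s)%O.
Proof. exact/is_faceS/is_face_refl. Qed.

Lemma d_0_le (e : S 1) : (simp (d_0 e) <= simp e)%O. Proof. exact: le_face. Qed.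

Lemma d_1_le (e : S 1) : (simp (d_1 e) <= simp e)%O. Proof. exact: le_face. Qed.

(* The vertices of a 2-simplex [v_0, v_1, v_2]; the transports R_01, R_02, R_12
   have these as endpoints up to the following semisimplicial identities. *)
Definition v_0 (s : S 2) : S 0 := d_1 (d_2 s).
Definition v_1 (s : S 2) : S 0 := d_0 (d_2 s).
Definition v_2 (s : S 2) : S 0 := d_0 (d_0 s).

Lemma v_0E (s : S 2) : v_0 s = d_1 (d_1 s).
Proof.
have := @face_face n S 0 (Ordinal (isT : 1 < 2)%N) (Ordinal (isT : 1 < 2)%N) s isT.
rewrite (_ : fintype.lift _ _ = Ordinal (isT : 2 < 3)%N); last exact: val_inj.
by rewrite (_ : widen_ord _ _ = Ordinal (isT : 1 < 3)%N); last exact: val_inj.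
Qed.

Lemma v_1E (s : S 2) : v_1 s = d_1 (d_0 s).
Proof.
have := @face_face n S 0 (Ordinal (isT : 0 < 2)%N) (Ordinal (isT : 1 < 2)%N) s isT.
rewrite (_ : fintype.lift _ _ = Ordinal (isT : 2 < 3)%N); last exact: val_inj.
by rewrite (_ : widen_ord _ _ = Ordinal (isT : 0 < 3)%N); last exact: val_inj.
Qed.

Lemma v_2E (s : S 2) : v_2 s = d_0 (d_1 s).
Proof.
have := @face_face n S 0 (Ordinal (isT : 0 < 2)%N) (Ordinal (isT : 0 < 2)%N) s isT.
rewrite (_ : fintype.lift _ _ = Ordinal (isT : 1 < 3)%N); last exact: val_inj.
by rewrite (_ : widen_ord _ _ = Ordinal (isT : 0 < 3)%N); last exact: val_inj.
Qed.

Lemma vertices2 (s : S 2) : vertices s = [:: v_0 s; v_1 s; v_2 s].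
Proof.
rewrite /= (_ : ord_max = Ordinal (isT : 2 < 3)%N); last exact: val_inj.
rewrite (_ : ord_max = Ordinal (isT : 1 < 2)%N); last exact: val_inj.
rewrite (_ : @ord0 2 = Ordinal (isT : 0 < 3)%N); last exact: val_inj.
rewrite (_ : @ord0 1 = Ordinal (isT : 0 < 2)%N); last exact: val_inj.
by rewrite v_1E.
Qed.

End FacePoset.

Definition is_iso {k : fieldType} {V W : vectType k} (f : 'Hom(V, W)) : Prop :=
  exists g : 'Hom(W, V), (g \o f = \1)%VF /\ (f \o g = \1)%VF.

Definition eq_hom {k : fieldType} {V W : vectType k} (e : V = W) : 'Hom(V, W) :=
  match e in _ = W return 'Hom(V, W) with erefl => \1%VF end.

Record vect_functor (k : fieldType) (d : Order.disp_t) (P : porderType d) := VectFunctor {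
  fobj :> P -> vectType k;
  fmap : forall x y : P, (x <= y)%O -> 'Hom(fobj x, fobj y);
  fmap_id : forall (x : P) (xx : (x <= x)%O), fmap xx = \1%VF;
  fmap_comp : forall (x y z : P) (xy : (x <= y)%O) (yz : (y <= z)%O) (xz : (x <= z)%O),
    fmap xz = (fmap yz \o fmap xy)%VF }.

Arguments fmap {k d P} _ {x y} _.

Record nat_iso (k : fieldType) (d : Order.disp_t) (P : porderType d)
    (F G : vect_functor k P) := NatIso {
  component :> forall x : P, 'Hom(F x, G x);
  component_iso : forall x : P, is_iso (component x);
  naturality : forall (x y : P) (xy : (x <= y)%O),
    (component y \o fmap F xy = fmap G xy \o component x)%VF }.

Record connection_sheaf (k : fieldType) (n : nat) (S : semisimplicial n) := ConnectionSheaf {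
  sheaf_functor :> vect_functor k (face_poset S);
  sheaf_iso : forall (x y : face_poset S) (xy : (x <= y)%O), is_iso (fmap sheaf_functor xy) }.

Section Extensions.
Context {k : fieldType} {n : nat} {S : semisimplicial n}.
Variable E : S 0 -> vectType k.

Definition vertex_spaces (F : connection_sheaf k S) : Prop :=
  forall v : S 0, F (simp v) = E v.

(* R_e = F(d_0 e <= e)^-1 o F(d_1 e <= e), read through the equalities
   F(d_1 e) = E_(d_1 e) and F(d_0 e) = E_(d_0 e). *)
Definition edge_transports (R : forall e : S 1, 'Hom(E (d_1 e), E (d_0 e)))
    (F : connection_sheaf k S) (FE : vertex_spaces F) : Prop :=
  forall e : S 1,
    R e = (eq_hom (FE (d_0 e))
           \o ((fmap F (d_0_le e))^-1 \o fmap F (d_1_le e))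
           \o eq_hom (esym (FE (d_1 e))))%VF.

(* The condition on [h] at a vertex v says h_v = id_(E_v). *)
Definition cellular_gauge (F F' : connection_sheaf k S)
    (FE : vertex_spaces F) (FE' : vertex_spaces F') (h : nat_iso F F') : Prop :=
  forall v : S 0, h (simp v) = eq_hom (etrans (FE v) (esym (FE' v))).

End Extensions.

(* U (x)_A V is the free abelian group on U * V modulo the subgroup generated by
   the biadditivity and balancing relations.  Only the actions of A enter. *)
Section Tensor.
Context {A : Type} {U V : zmodType} (ract : U -> A -> U) (lact : A -> V -> V).

Inductive tensor_relation : {freeg (U * V)} -> Prop :=
| tensor_relation0 : tensor_relation 0
| tensor_relationB x y :
    tensor_relation x -> tensor_relation y -> tensor_relation (x - y)
| tensor_relationDl u u' v :
    tensor_relation (<< (u + u', v) >> - << (u, v) >> - << (u', v) >>)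
| tensor_relationDr u v v' :
    tensor_relation (<< (u, v + v') >> - << (u, v) >> - << (u, v') >>)
| tensor_relationA u a v :
    tensor_relation (<< (ract u a, v) >> - << (u, lact a v) >>).

Definition tensor_relations : {pred {freeg (U * V)}} :=
  fun x => `[< tensor_relation x >].

Fact tensor_relations_closed : zmod_closed tensor_relations.
Proof.
split=> [|x y]; first exact/asboolP/tensor_relation0.
by move=> /asboolP hx /asboolP hy; apply/asboolP/tensor_relationB.
Qed.

HB.instance Definition _ :=
  GRing.isZmodClosed.Build {freeg (U * V)} tensor_relations tensor_relations_closed.

Definition tensor : Type := Quotient.quot tensor_relations.
HB.instance Definition _ := GRing.Zmodule.on tensor.

Definition tens (u : U) (v : V) : tensor := \pi_(Quotient.quot tensor_relations)%qT << (u, v) >>.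

(* The additive map sending u (x) v to f u v, for a biadditive balanced f: see
   [tensor_liftE] and [tensor_liftB]. *)
Definition tensor_lift {G : zmodType} (f : U -> V -> G) (t : tensor) : G :=
  fglift (fun uv : U * V => f uv.1 uv.2 : zmodule G) (repr (t : Quotient.quot tensor_relations)).

Lemma tensDl u u' v : tens (u + u') v = tens u v + tens u' v.
Proof.
rewrite /tens -raddfD; apply/eqmodP; rewrite /= Quotient.equivE opprD addrA.
exact/asboolP/tensor_relationDl.
Qed.

Lemma tensDr u v v' : tens u (v + v') = tens u v + tens u v'.
Proof.
rewrite /tens -raddfD; apply/eqmodP; rewrite /= Quotient.equivE opprD addrA.
exact/asboolP/tensor_relationDr.
Qed.

Lemma tensA u a v : tens (ract u a) v = tens u (lact a v).
Proof. by apply/eqmodP; rewrite /= Quotient.equivE; apply/asboolP/tensor_relationA. Qed.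

Section Lift.
Context {G : zmodType} (f : U -> V -> G).
Hypotheses (fDl : forall v, {morph f^~ v : u u' / u + u'})
           (fDr : forall u, {morph f u : v v' / v + v'})
           (fA : forall u a v, f (ract u a) v = f u (lact a v)).

Let g (x : {freeg (U * V)}) : G := fglift (fun uv : U * V => f uv.1 uv.2 : zmodule G) x.

Let gB : {morph g : x y / x - y}.
Proof. by move=> x y; apply: (@lift_is_additive _ _ (zmodule G)). Qed.

Let gU u v : g << (u, v) >> = f u v.
Proof. by rewrite /g liftU scale1r. Qed.

Let g_relation x : tensor_relation x -> g x = 0.
Proof.
elim=> [|y z _ gy _ gz|u u' v|u v v'|u a v]; rewrite ?gB ?gU.
- by rewrite -[0](subrr 0) gB subrr.
- by rewrite gy gz subrr.
- by rewrite fDl -addrA -opprD subrr.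
- by rewrite fDr -addrA -opprD subrr.
- by rewrite fA subrr.
Qed.

Let g_pi x : tensor_lift f (\pi_(Quotient.quot tensor_relations)%qT x) = g x.
Proof.
apply/eqP; rewrite -subr_eq0 -gB; apply/eqP/g_relation/asboolP.
by have /eqmodP := reprK (\pi_(Quotient.quot tensor_relations)%qT x).
Qed.

Lemma tensor_liftE u v : tensor_lift f (tens u v) = f u v.
Proof. by rewrite g_pi gU. Qed.

Lemma tensor_liftB : {morph tensor_lift f : s t / s - t}.
Proof.
move=> s t; rewrite -[s]reprK -[t]reprK.
by rewrite -[X in tensor_lift f X]raddfB !g_pi gB.
Qed.

End Lift.

End Tensor.

Section DirectSum.
Context {I : finType} (E : I -> zmodType).

Definition direct_sum : Type := {dffun forall i : I, E i}.
HB.instance Definition _ := Choice.on direct_sum.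
Implicit Types x y z : direct_sum.

Definition ds_zero : direct_sum := [ffun i : I => 0 : E i].
Definition ds_opp x : direct_sum := [ffun i : I => - x i].
Definition ds_add x y : direct_sum := [ffun i : I => x i + y i].

Fact ds_addA : associative ds_add.
Proof. by move=> x y z; apply/ffunP=> i; rewrite !ffunE addrA. Qed.
Fact ds_addC : commutative ds_add.
Proof. by move=> x y; apply/ffunP=> i; rewrite !ffunE addrC. Qed.
Fact ds_add0 : left_id ds_zero ds_add.
Proof. by move=> x; apply/ffunP=> i; rewrite !ffunE add0r. Qed.
Fact ds_addN : left_inverse ds_zero ds_opp ds_add.
Proof. by move=> x; apply/ffunP=> i; rewrite !ffunE addNr. Qed.
HB.instance Definition _ :=
  GRing.isZmodule.Build direct_sum ds_addA ds_addC ds_add0 ds_addN.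

Definition ds_incl (i : I) (a : E i) : direct_sum :=
  [ffun j : I => dfwith (fun j => 0 : E j) a j].

End DirectSum.

Section Forms.
Variables (k : fieldType) (n : nat) (S : semisimplicial n).

Definition Omega (p : nat) : Type := {ffun S p -> k^o}.
HB.instance Definition _ p := GRing.Lmodule.on (Omega p).

Definition rho {p : nat} (s : S p) : Omega p := [ffun t => (t == s)%:R].

(* The product of rho_s and rho_t; there is at most one simplex u to sum over,
   since vertices determine simplices.  The product of a p-form and a q-form
   lives in degree r = p + q; leaving r free avoids casts between, e.g.,
   degrees p + 1 and p.+1, and in any other degree the sum below is empty. *)
Definition wedge_basis {p q : nat} (r : nat) (s : S p) (t : S q) : Omega r :=
  if last_vertex s == first_vertex t then
    \sum_(u : S r | vertices u == vertices s ++ behead (vertices t)) rho u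
  else 0.

Definition wedge {p q : nat} (r : nat) (a : Omega p) (b : Omega q) : Omega r :=
  \sum_(s : S p) \sum_(t : S q) (a s * b t) *: wedge_basis r s t.

Definition Omega_d {p : nat} (a : Omega p) : Omega p.+1 :=
  \sum_(s : S p) a s *: \sum_(j < p.+2) (-1) ^+ j *: \sum_(t : S p.+1 | face S j t == s) rho t.

(* The right action on forms of the ring A_S = Omega 0 *)
Definition Omega_act {p : nat} (a : Omega p) (f : Omega 0) : Omega p := wedge p a f.

End Forms.

Arguments rho {k n S p} s.
Arguments wedge_basis {k n S p q} r s t.
Arguments wedge {k n S p q} r a b.
Arguments Omega_d {k n S p} a.
Arguments Omega_act {k n S p} a f.

Section Connection.
Context {k : fieldType} {n : nat} {S : semisimplicial n}.
Variables (E : S 0 -> vectType k) (R : forall e : S 1, 'Hom(E (d_1 e), E (d_0 e))).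

Definition total_space : zmodType := direct_sum (fun v : S 0 => E v : zmodType).

(* In particular rho_[v] acts as the projection onto E_v. *)
Definition total_act (f : Omega k S 0) (x : total_space) : total_space :=
  [ffun v : S 0 => (f v : k) *: x v].

Definition Omega_tensor (p : nat) : zmodType := tensor (@Omega_act k n S p) total_act.

Definition ftens {p : nat} (a : Omega k S p) (x : total_space) : Omega_tensor p :=
  tens _ _ a x.

Definition nabla (x : total_space) : Omega_tensor 1 :=
  \sum_(e : S 1) ftens (rho e) (ds_incl (E := E) (x (d_0 e) - R e (x (d_1 e)))).

(* a /\ (b (x) x) = (a /\ b) (x) x *)
Definition tensor_wedge {p q : nat} (r : nat) (a : Omega k S p) : Omega_tensor q -> Omega_tensor r :=
  tensor_lift (fun (b : Omega k S q) (x : total_space) => ftens (wedge r a b) x).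

Definition nabla_hat {p : nat} : Omega_tensor p -> Omega_tensor p.+1 :=
  tensor_lift (fun (a : Omega k S p) (x : total_space) =>
    ftens (Omega_d a) x + tensor_wedge p.+1 ((-1) ^+ p *: a) (nabla x)).

(* M is identified with Omega^0 (x) M, on which nabla_hat restricts to nabla. *)
Definition curvature (x : total_space) : Omega_tensor 2 := nabla_hat (nabla x).

(* [K] is the family of maps (K_nabla)_s with
   K_nabla(x) = sum_s rho_s (x) (K_nabla)_s(delta_(v_0) x). *)
Definition curvature_components (K : forall s : S 2, 'Hom(E (v_0 s), E (v_2 s))) : Prop :=
  forall x : total_space,
    curvature x = \sum_(s : S 2) ftens (rho s) (ds_incl (E := E) (K s (x (v_0 s)))).

(* (K_nabla)_s = 0, for the unique family of components of the curvature *)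
Definition curvature_zero_on (s : S 2) : Prop :=
  exists2 K, curvature_components K & K s = 0.

Definition R_01 (s : S 2) : 'Hom(E (v_0 s), E (v_1 s)) := R (d_2 s).
Definition R_12 (s : S 2) : 'Hom(E (v_1 s), E (v_2 s)) :=
  (R (d_0 s) \o eq_hom (congr1 E (v_1E s)))%VF.
Definition R_02 (s : S 2) : 'Hom(E (v_0 s), E (v_2 s)) :=
  (eq_hom (congr1 E (esym (v_2E s))) \o R (d_1 s) \o eq_hom (congr1 E (v_0E s)))%VF.

End Connection.

(* Main.v *)
Require Import Defs.
From mathcomp Require freeg.
From mathcomp Require Import all_boot all_order all_algebra.
From mathcomp Require Import boolp.

(* (i) <-> (ii): Omega^p (x)_A M is the direct sum over the p-simplices s of
   E_w, w the last vertex of s.  Reading off the coefficient of a 2-simplex gives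
   K_s = R_02 - R_12 R_01.
   (i) <-> (iii): under (i) put F(x) = E_w, w the last vertex of x, and let
   x <= y act by the transport along the edge of y from the last vertex of x to
   that of y; the 2-simplices of z give functoriality for x <= y <= z.
   Conversely the transports F(w <= x)^-1 F(v <= x) between the vertices of x
   compose.  The gauge between two extensions is F'(w <= x) F(w <= x)^-1, w any
   vertex of x, up to the identifications with E_w; it is natural because both
   sheaves have the same transports along the edges of x. *)

Set Implicit Arguments.
Unset Strict Implicit.
Unset Printing Implicit Defensive.

Import Order.TTheory GRing.Theory.
Local Open Scope ring_scope.

(** * Subsequences of a finite sequence *)

(** Match m greedily along l and delete the first entry of l that fails to match. For vertex
    sequences this deletion is a face map. *)
Lemma subseq_delete (T : eqType) (m l : seq T) : subseq m l -> m != l ->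
  exists2 j, (j < size l)%N & subseq m (take j l ++ drop j.+1 l).
Proof.
elim: l m => [|y l IHl] [|x m] //=.
  by move=> _ _; exists 0%N; rewrite ?sub0seq.
case: eqP => [->|_] sml; last by exists 0%N; rewrite //= drop0.
rewrite eqseq_cons eqxx => /(IHl _ sml)[j lt_j sub_j].
by exists j.+1; rewrite //= eqxx.
Qed.

Lemma mem_last_subseq (T : eqType) (x0 v w : T) (l : seq T) :
  v != w -> v \in l -> last x0 l = w -> subseq [:: v; w] l.
Proof.
case/lastP: l => // l y ne_vw; rewrite last_rcons mem_rcons inE => + eq_y.
rewrite eq_y (negbTE ne_vw) /= => v_l; rewrite -cats1.
by rewrite -[[:: v; w]]/([:: v] ++ [:: w]) cat_subseq // sub1seq.
Qed.

(** The last entry of l cannot serve as w, so v and w already occur in order before it. *)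
Lemma subseq_last_cons (T : eqType) (x0 v w z : T) (l : seq T) :
  w != z -> subseq [:: v; w] l -> last x0 l = z -> subseq [:: v; w; z] l.
Proof.
case/lastP: l => // l y ne_wz sub_l; rewrite last_rcons => eq_y.
move: sub_l; rewrite eq_y -cats1 -[[:: v; w; z]]/([:: v; w] ++ [:: z]) => sub_l.
apply: cat_subseq => //; move: sub_l.
rewrite -subseq_rev rev_cat => sub_l; rewrite -subseq_rev.
by move: sub_l; rewrite -[rev [:: v; w]]/[:: w; v] /= (negbTE ne_wz).
Qed.

(** * Vertex sequences and the face order *)

Section Simplices.
Context {n : nat} {S : semisimplicial n}.

Lemma vertices_cons p (s : S p.+1) :
  vertices s = first_vertex s :: vertices (face S ord0 s).
Proof. by []. Qed.

Lemma first_vertexE p (s : S p) v : head v (vertices s) = first_vertex s.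
Proof. by case: p s. Qed.

Lemma last_vertexE p (s : S p) v : last v (vertices s) = last_vertex s.
Proof. by elim: p s v => [|p IHp] s v //=; rewrite IHp. Qed.

Lemma last_vertex_mem p (s : S p) : last_vertex s \in vertices s.
Proof.
rewrite -(last_vertexE s (first_vertex s)).
case: p s => [|p] s; first exact: mem_head.
by rewrite vertices_cons; exact: (mem_last (first_vertex s) (vertices (face S ord0 s))).
Qed.

Lemma size_vertices p (s : S p) : size (vertices s) = p.+1.
Proof. by elim: p s => //= p IHp s; rewrite IHp. Qed.

(** For the top index this is the definition of [first_vertex]. For smaller j, deleting the top
    vertex commutes with d_j and induction applies. *)
Lemma first_vertex_face p (j : 'I_p.+2) (s : S p.+1) :
  j != ord0 -> first_vertex (face S j s) = first_vertex s.
Proof.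
elim: p j s => [|p IHp] j s nz_j.
  by rewrite (_ : j = ord_max) //; apply/val_inj; case: j nz_j => [[|[|]]].
have [j_le|] := leqP j p.+1; last first.
  move=> lt_j; rewrite (_ : j = ord_max) //; apply/val_inj/eqP => /=.
  by rewrite eqn_leq lt_j -ltnS ltn_ord.
pose j' : 'I_p.+2 := Ordinal (j_le : (j < p.+2)%N).
have := @face_face n S p j' ord_max s j_le.
rewrite (_ : widen_ord _ _ = j); last exact: val_inj.
rewrite (_ : fintype.lift _ _ = ord_max); last exact: val_inj.
move=> eq_face; rewrite /= -eq_face IHp //.
Qed.

(** The case j = 0 is the definition of [vertices]. For j = i + 1 the head is kept, and d_0 d_(i+1)
    = d_i d_0 reduces the tail to the induction hypothesis. *)
Lemma vertices_face p (j : 'I_p.+2) (s : S p.+1) :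
  vertices (face S j s) = take j (vertices s) ++ drop j.+1 (vertices s).
Proof.
elim: p j s => [|p IHp] j s.
  case: (unliftP ord0 j) => [i|] -> //=.
  have ->: i = ord0 by apply/val_inj; case: i => [[|]].
  by rewrite (_ : fintype.lift _ _ = ord_max) //; apply: val_inj.
case: (unliftP ord0 j) => [i|] ->; last by [].
have := @face_face n S p ord0 i s isT.
rewrite (_ : widen_ord _ _ = ord0); last exact: val_inj.
move=> eq_face; rewrite !vertices_cons first_vertex_face //.
by rewrite eq_face IHp.
Qed.

Lemma vertices1 (e : S 1) : vertices e = [:: d_1 e; d_0 e].
Proof.
rewrite /= (_ : ord_max = Ordinal (isT : 1 < 2)%N); last exact: val_inj.
by rewrite (_ : ord0 = Ordinal (isT : 0 < 2)%N); last exact: val_inj.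
Qed.

Lemma last_vertex1 (e : S 1) : last_vertex e = d_0 e.
Proof. by rewrite -(last_vertexE e (d_0 e)) vertices1. Qed.

Lemma last_vertex2 (s : S 2) : last_vertex s = v_2 s.
Proof. by rewrite -(last_vertexE s (v_2 s)) vertices2. Qed.

Lemma last_vertex_le p (s : S p) : (simp (last_vertex s) <= simp s)%O.
Proof.
by elim: p s => [|p IHp] s //=; apply: le_trans (IHp _) (le_face _ _).
Qed.

Lemma subseq_vertices (x y : face_poset S) :
  (x <= y)%O -> subseq (vertices (tagged x)) (vertices (tagged y)).
Proof.
case: y => q t; rewrite /Order.le /= /face_le /=.
elim: q t => [|q IHq] t; first by move/eqP->; apply: subseq_refl.
rewrite [is_face _ _]/= => /orP[/eqP->|/existsP[j /IHq sub_j]]; first exact: subseq_refl.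
apply: subseq_trans sub_j _; rewrite vertices_face.
rewrite -[X in subseq _ X](cat_take_drop j (vertices t)) cat_subseq //.
rewrite -add1n -drop_drop; exact: drop_subseq.
Qed.

(** The vertices missing from m are deleted one at a time, each by a face map. *)
Lemma subseq_vertices_face q (t : S q) (m : seq (S 0)) :
  m != [::] -> subseq m (vertices t) ->
  exists2 x : face_poset S, (x <= simp t)%O & vertices (tagged x) = m.
Proof.
move=> nz_m; elim: q t => [|q IHq] t sub_m; have [eq_m|ne_m] := eqVneq m (vertices t).
- by exists (simp t).
(* A sequence with one entry has no proper nonempty subsequence. *)
- have [/= le_m] := size_subseq_leqif sub_m; rewrite (negbTE ne_m).
  by move: le_m nz_m; case: (m) => [|v [|w l]].
- by exists (simp t).
have [j lt_j] := subseq_delete sub_m ne_m; rewrite size_vertices in lt_j.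
rewrite -(vertices_face (Ordinal lt_j)) => /IHq[x le_x eq_x].
by exists x => //; apply: le_trans le_x (le_face _ _).
Qed.

(** The number of vertices fixes the dimension of the face found, so it can be read as a
    1-simplex. *)
Lemma edge_of_vertices q (t : S q) v w : subseq [:: v; w] (vertices t) ->
  exists e : S 1, [/\ d_1 e = v, d_0 e = w & (simp e <= simp t)%O].
Proof.
case/subseq_vertices_face=> // -[p e] le_e /= eq_e.
move: (size_vertices e); rewrite eq_e => -[dim_e].
by case: p / dim_e e le_e eq_e => e le_e; rewrite vertices1 => -[? ?]; exists e.
Qed.

Lemma triangle_of_vertices q (t : S q) u v w : subseq [:: u; v; w] (vertices t) ->
  exists s : S 2, [/\ v_0 s = u, v_1 s = v & v_2 s = w].
Proof.
case/subseq_vertices_face=> // -[p s] le_s /= eq_s.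
move: (size_vertices s); rewrite eq_s => -[dim_s].
by case: p / dim_s s le_s eq_s => s le_s; rewrite vertices2 => -[? ? ?]; exists s.
Qed.

Lemma last_vertices_subseq (x y : face_poset S) : (x <= y)%O ->
  last_vertex (tagged x) != last_vertex (tagged y) ->
  subseq [:: last_vertex (tagged x); last_vertex (tagged y)] (vertices (tagged y)).
Proof.
move=> /subseq_vertices sub_xy ne_xy; set v := last_vertex (tagged x).
apply: (mem_last_subseq (x0 := v)) => //; last exact: last_vertexE.
exact: (mem_subseq sub_xy (last_vertex_mem _)).
Qed.

(** The edge found here carries the transport attached to x <= y. *)
Lemma last_vertex_edge (x y : face_poset S) : (x <= y)%O ->
  last_vertex (tagged x) = last_vertex (tagged y) \/
  exists e : S 1, [/\ d_1 e = last_vertex (tagged x), d_0 e = last_vertex (tagged y)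
    & (simp e <= y)%O].
Proof.
case: y => q t le_xy.
have [|/(last_vertices_subseq le_xy)/edge_of_vertices] :=
  eqVneq (last_vertex (tagged x)) (last_vertex t); [by left|by right].
Qed.

End Simplices.

(** * Casts between equal spaces, and inclusions into the direct sum *)

Section EqHom.
Context {k : fieldType}.

Lemma eq_hom_inj {V W : vectType k} (e e' : V = W) : eq_hom e = eq_hom e'.
Proof. by rewrite (Prop_irrelevance e e'). Qed.

End EqHom.

Section DirectSumFacts.
Context {I : finType} (E : I -> zmodType).

Lemma ds_inclD i : {morph @ds_incl I E i : a b / a + b}.
Proof.
move=> a b; apply/ffunP=> j; rewrite [RHS]ffunE !ffunE.
have [<-|ne_ij] := eqVneq i j; first by rewrite !dfwith_in.
by rewrite !dfwith_out // addr0.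
Qed.

End DirectSumFacts.

(** * Coefficients of products and differentials of forms *)

Section Forms.
Context {k : fieldType} {n : nat} {S : semisimplicial n}.
Hypothesis nsS : nonsingular S.

Lemma sum_rho (p : nat) (P : pred (S p)) (u : S p) :
  (\sum_(s | P s) rho s : Omega k S p) u = (P u)%:R.
Proof.
rewrite sum_ffunE big_mkcond (bigD1 u) //= big1 => [|s /negbTE ne_su].
  by rewrite ffunE eqxx addr0; case: (P u).
by rewrite ffunE eq_sym ne_su; case: ifP.
Qed.

Lemma sum_delta (p : nat) (V : lmodType k) (F : S p -> V) (u : S p) :
  \sum_s ((rho s : Omega k S p) u : k) *: F s = F u.
Proof.
rewrite (bigD1 u) //= big1 => [|s /negbTE ne_su]; rewrite ffunE.
  by rewrite eqxx scale1r addr0.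
by rewrite eq_sym ne_su scale0r.
Qed.

(** Only the product of rho_u with the indicator of its last vertex contributes at u, since vertices
    determine simplices. *)
Lemma Omega_actE (p : nat) (a : Omega k S p) (f : Omega k S 0) (u : S p) :
  Omega_act a f u = a u * f (last_vertex u).
Proof.
rewrite /Omega_act /wedge sum_ffunE (bigD1 u) //= [X in _ + X]big1 => [|s ne_su].
  rewrite addr0 sum_ffunE (bigD1 (last_vertex u)) //= big1 => [|v ne_v].
    rewrite ffunE /wedge_basis /= eqxx sum_rho cats0 eqxx addr0.
    exact: mulr1.
  by rewrite ffunE /wedge_basis /= eq_sym (negbTE ne_v) ffunE; exact: mulr0.
rewrite sum_ffunE big1 // => v _; rewrite ffunE /wedge_basis /=.
case: ifP => _; last by rewrite ffunE; exact: mulr0.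
rewrite sum_rho cats0 (inj_eq (@vertices_determine _ _ nsS p)) eq_sym (negbTE ne_su).
exact: mulr0.
Qed.

(** The edges d_2 u and d_0 u are the only pair whose concatenated vertices are those of u. *)
Lemma wedge11E (a b : Omega k S 1) (u : S 2) :
  wedge 2 a b u = a (d_2 u) * b (d_0 u).
Proof.
have basisE (s t : S 1) :
    (wedge_basis 2 s t : Omega k S 2) u = ((s == d_2 u) && (t == d_0 u))%:R.
  rewrite /wedge_basis (fun_if (fun w : Omega k S 2 => w u)) sum_rho ffunE.
  rewrite -!(inj_eq (@vertices_determine _ _ nsS 1)) !vertices1 last_vertex1.
  rewrite -(first_vertexE t (d_1 t)) vertices1 vertices2 /= -v_1E !eqseq_cons !andbT.
  rewrite -/(v_0 u) -/(v_1 u) -/(v_2 u) eq_sym (eq_sym (v_1 u)) (eq_sym (v_2 u)).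
  rewrite (eq_sym (v_0 u)); case: (d_1 s == _) => /=; last by case: ifP.
  have [->|ne_st] := eqVneq (d_1 t) (d_0 s).
    by case: (d_0 s == _).
  by have [<-|] := eqVneq (d_0 s) (v_1 u); rewrite ?(negbTE ne_st).
rewrite /wedge sum_ffunE (bigD1 (d_2 u)) //= [X in _ + X]big1 => [|s ne_s].
  rewrite addr0 sum_ffunE (bigD1 (d_0 u)) //= big1 => [|t ne_t]; rewrite ffunE basisE.
    by rewrite !eqxx addr0; exact: mulr1.
  by rewrite (negbTE ne_t) andbF; exact: mulr0.
rewrite sum_ffunE big1 // => t _; rewrite ffunE basisE (negbTE ne_s).
exact: mulr0.
Qed.

Lemma Omega_dE (p : nat) (a : Omega k S p) (u : S p.+1) :
  Omega_d a u = \sum_(j < p.+2) (-1) ^+ j * a (face S j u).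
Proof.
transitivity (\sum_s \sum_(j < p.+2) (-1) ^+ j * a s * (face S j u == s)%:R : k).
  rewrite /Omega_d sum_ffunE; apply: eq_bigr => s _.
  rewrite ffunE sum_ffunE /GRing.scale /= mulr_sumr; apply: eq_bigr => j _.
  by rewrite ffunE sum_rho /GRing.scale /= mulrCA mulrA.
rewrite exchange_big; apply: eq_bigr => j _.
rewrite (bigD1 (face S j u)) //= big1 => [|s ne_s]; first by rewrite eqxx mulr1 addr0.
by rewrite eq_sym (negbTE ne_s) mulr0.
Qed.

Lemma Omega_d1E (a : Omega k S 1) (u : S 2) :
  Omega_d a u = a (d_0 u) - a (d_1 u) + a (d_2 u).
Proof.
rewrite Omega_dE !big_ord_recl big_ord0 /= /bump /= addr0 sqrrN expr1n !mul1r mulN1r addrA.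
by congr (a _ - a _ + a _); congr (face S _ u); apply: val_inj.
Qed.

End Forms.

(** * Induction on tensors *)

Section TensorInd.
Context {A : Type} {U V : zmodType} (ract : U -> A -> U) (lact : A -> V -> V).

Lemma tens0l v : tens ract lact 0 v = 0.
Proof. by apply: (addrI (tens ract lact 0 v)); rewrite -tensDl !addr0. Qed.

(** A tensor is an integer combination of pure tensors, and zero, sums and integer multiples all
    arise from differences. *)
Lemma tensor_ind (P : tensor ract lact -> Prop) :
  (forall u v, P (tens ract lact u v)) -> (forall s t, P s -> P t -> P (s - t)) ->
  forall t, P t.
Proof.
move=> P_tens PB; have P0 : P 0 by rewrite -(tens0l 0).
have PD s t : P s -> P t -> P (s + t).
  by move=> Ps Pt; rewrite -[t]opprK; apply: (PB) => //; rewrite -sub0r; apply: (PB).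
move=> t; rewrite -[t]reprK; elim/freeg.freeg_ind_dom0: (repr _) => [|m [u v] D _ _ PD'].
  by rewrite raddf0.
rewrite raddfD; apply: (PD) => //; rewrite -[m]intz -freeg.freegU_mulz raddfMz.
set w := (X in X *~ _); have Pw : P w := P_tens u v.
have Pwn i : P (w *+ i).
  by elim: i => [|i IHi]; [rewrite mulr0n; exact: P0|rewrite mulrS; exact: PD].
case: m => m; first by rewrite -pmulrn; exact: Pwn.
by rewrite NegzE -nmulrn -sub0r; apply: (PB) => //; exact: Pwn.
Qed.

End TensorInd.

(** * Coefficients of tensors of forms with the total space *)

Section Coefficients.
Context {k : fieldType} {n : nat} {S : semisimplicial n}.
Hypothesis nsS : nonsingular S.
Variable E : S 0 -> vectType k.
Implicit Types x y : total_space E.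

Lemma total_actE (f : Omega k S 0) x v : total_act f x v = (f v : k) *: x v.
Proof. exact: ffunE. Qed.

Lemma total_spaceD x y v : (x + y) v = x v + y v.
Proof. exact: ffunE. Qed.

Lemma total_space_cast x i j (ij : i = j) : x j = eq_hom (congr1 E ij) (x i).
Proof. by case: j / ij; rewrite /= id_lfunE. Qed.

Lemma ds_incl_cast i j (ij : i = j) (a : E i) :
  (ds_incl a : total_space E) j = eq_hom (congr1 E ij) a.
Proof. by case: j / ij; rewrite /= id_lfunE ffunE dfwith_in. Qed.

Lemma ds_incl_id i (a : E i) : (ds_incl a : total_space E) i = a.
Proof. by rewrite (ds_incl_cast (erefl i)) /= id_lfunE. Qed.

(** Balanced when v is the last vertex of s, because the right action scales a_s by the value there.
    The vertex is a separate argument so that [d_0 e] or [v_2 u] can stand for it without casts. *)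
Definition tcoef {p : nat} (s : S p) (v : S 0) : Omega_tensor E p -> E v :=
  tensor_lift (fun (a : Omega k S p) x => (a s : k) *: (x v : E v)).

Section Coef.
Variables (p : nat) (s : S p) (v : S 0).
Hypothesis last_s : last_vertex s = v.

Let fDl x : {morph (fun a : Omega k S p => (a s : k) *: (x v : E v)) : a b / a + b}.
Proof. by move=> a b; rewrite ffunE scalerDl. Qed.
Let fDr (a : Omega k S p) : {morph (fun x => (a s : k) *: (x v : E v)) : x y / x + y}.
Proof. by move=> x y; rewrite total_spaceD scalerDr. Qed.
Let fA (a : Omega k S p) f x :
  (Omega_act a f s : k) *: (x v : E v) = (a s : k) *: (total_act f x v : E v).
Proof. by rewrite (Omega_actE nsS) total_actE last_s scalerA. Qed.

Lemma tcoefE (a : Omega k S p) x : tcoef s v (ftens a x) = (a s : k) *: (x v : E v).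
Proof. exact: (tensor_liftE fDl fDr fA). Qed.

Lemma tcoefB : {morph tcoef s v : t u / t - u}.
Proof. exact: (tensor_liftB fDl fDr fA). Qed.

Lemma tcoef0 : tcoef s v 0 = 0.
Proof. by rewrite -[0 in LHS](subrr 0) tcoefB subrr. Qed.

Lemma tcoefD : {morph tcoef s v : t u / t + u}.
Proof. by move=> t u; rewrite -{1}[u]opprK -[- u]sub0r !tcoefB tcoef0 sub0r opprK. Qed.

Lemma tcoef_sum I (r : seq I) (P : pred I) (F : I -> Omega_tensor E p) :
  tcoef s v (\sum_(i <- r | P i) F i) = \sum_(i <- r | P i) tcoef s v (F i).
Proof. exact: (big_morph _ tcoefD tcoef0). Qed.

Lemma tcoef_sum_rho (y : forall t : S p, total_space E) :
  tcoef s v (\sum_t ftens (rho t) (y t)) = y s v.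
Proof.
rewrite tcoef_sum; under eq_bigr do rewrite tcoefE.
exact: (sum_delta (fun t => y t v : E v)).
Qed.

End Coef.

Lemma Omega_sumE p (a : Omega k S p) : a = \sum_s (a s : k) *: rho s.
Proof.
apply/ffunP=> s; rewrite sum_ffunE -[LHS](sum_delta (fun t => a t : k^o)).
by apply: eq_bigr => t _; rewrite [RHS]ffunE; exact: mulrC.
Qed.

(** Each rho_s absorbs the idempotent of its last vertex w. Moved across the tensor sign, this
    idempotent cuts x down to its component in E_w. *)
Lemma Omega_tensorE p (t : Omega_tensor E p) :
  t = \sum_s ftens (rho s) (ds_incl (E := E) (tcoef s (last_vertex s) t)).
Proof.
move: t; apply: tensor_ind => [a x|t u IHt IHu]; last first.
  rewrite {1}IHt {1}IHu -sumrB; apply: eq_bigr => s _.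
  rewrite tcoefB //; apply/eqP; rewrite subr_eq -tensDr -ds_inclD.
  by rewrite subrK.
rewrite {1}[a]Omega_sumE (big_morph (fun b => tens _ _ b x) (id1 := 0) (op1 := +%R));
  [|by move=> b c; exact: tensDl|exact: tens0l].
apply: eq_bigr => s _; rewrite -[tens _ _ a x]/(ftens a x) tcoefE //.
(* Balancing is over A_S, so the scalar a_s crosses the tensor sign as the function a_s delta_w. *)
have -> : a s *: rho s = Omega_act (rho s) ((a s : k) *: rho (last_vertex s)).
  apply/ffunP=> t; rewrite (Omega_actE nsS) !ffunE.
  by case: eqVneq => [->|_]; rewrite ?eqxx /GRing.scale /= ?mulr1 ?mul1r ?mulr0 ?mul0r.
rewrite /ftens tensA; congr tens; apply/ffunP=> v; rewrite total_actE !ffunE.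
have [<-|ne_v] := eqVneq (last_vertex s) v.
  by rewrite dfwith_in; congr (_ *: _); exact: mulr1.
by rewrite dfwith_out // scaler0 scale0r.
Qed.

(** Reduces equations between tensors, including biadditivity and balancing of maps into them, to
    one simplex at a time. *)
Lemma tensor_ext p (v : S p -> S 0) (t t' : Omega_tensor E p) :
  (forall s, last_vertex s = v s) ->
  (forall s, tcoef s (v s) t = tcoef s (v s) t') -> t = t'.
Proof.
move=> last_v eq_tt'; rewrite [t]Omega_tensorE [t']Omega_tensorE.
by apply: eq_bigr => s _; rewrite last_v eq_tt'.
Qed.

End Coefficients.

(** * The curvature on a 2-simplex *)

Section Curvature.
Context {k : fieldType} {n : nat} {S : semisimplicial n}.
Hypothesis nsS : nonsingular S.
Variables (E : S 0 -> vectType k) (R : forall e : S 1, 'Hom(E (d_1 e), E (d_0 e))).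
Implicit Types x y : total_space E.

Lemma tcoef_nabla (e : S 1) x :
  tcoef e (d_0 e) (nabla R x) = x (d_0 e) - R e (x (d_1 e)).
Proof. by rewrite (tcoef_sum_rho nsS (last_vertex1 e)) ds_incl_id. Qed.

(** The lift can be evaluated once the lifted map is biadditive and balanced, which is checked on
    coefficients. Induction on t then leaves pure tensors, settled by [wedge11E]. *)
Lemma tcoef_wedge (u : S 2) (a : Omega k S 1) (t : Omega_tensor E 1) :
  tcoef u (v_2 u) (tensor_wedge 2 a t) = (a (d_2 u) : k) *: tcoef (d_0 u) (v_2 u) t.
Proof.
pose f (b : Omega k S 1) x := ftens (wedge 2 a b) x.
have coef_f w b x : tcoef w (v_2 w) (f b x) =
    (a (d_2 w) : k) *: ((b (d_0 w) : k) *: (x (v_2 w) : E (v_2 w))).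
  by rewrite (tcoefE nsS (last_vertex2 w)) (wedge11E nsS) scalerA.
have fDl x : {morph f^~ x : b c / b + c}.
  move=> b c; apply: (tensor_ext nsS last_vertex2) => w.
  by rewrite (tcoefD nsS (last_vertex2 w)) !coef_f ffunE !scalerDl scalerDr.
have fDr b : {morph f b : x y / x + y}.
  by move=> x y; exact: tensDr.
have fA b g x : f (Omega_act b g) x = f b (total_act g x).
  apply: (tensor_ext nsS last_vertex2) => w.
  by rewrite !coef_f (Omega_actE nsS) total_actE (last_vertex1 (d_0 w)) !scalerA mulrA.
move: t; apply: tensor_ind => [b x|t t' IHt IHt'].
  have -> : tensor_wedge 2 a (tens Omega_act (@total_act _ _ _ E) b x) = f b x.
    exact: tensor_liftE.
  by rewrite coef_f -/(ftens b x) (tcoefE nsS (last_vertex1 _)).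
have -> : tensor_wedge 2 a (t - t') = tensor_wedge 2 a t - tensor_wedge 2 a t'.
  exact: tensor_liftB.
rewrite (tcoefB nsS (last_vertex2 u)) IHt IHt'.
by rewrite (tcoefB nsS (last_vertex1 (d_0 u))) scalerBr.
Qed.

(** The map whose lift is [nabla_hat] in degree 1. *)
Let nabla1 (a : Omega k S 1) x : Omega_tensor E 2 :=
  ftens (Omega_d a) x + tensor_wedge 2 ((-1) ^+ 1 *: a) (nabla R x).

(* In d a (x) x - a /\ nabla x the two terms a (d_2 u) x_(v_2) cancel. *)
Lemma tcoef_nabla1 (u : S 2) a x :
  tcoef u (v_2 u) (nabla1 a x) = ((a (d_0 u) - a (d_1 u)) : k) *: (x (v_2 u) : E (v_2 u))
    + (a (d_2 u) : k) *: R (d_0 u) (x (d_1 (d_0 u))).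
Proof.
rewrite (tcoefD nsS (last_vertex2 u)) (tcoefE nsS (last_vertex2 u)) tcoef_wedge.
rewrite [tcoef (d_0 u) _ _](tcoef_nabla (d_0 u)) Omega_d1E ffunE expr1 scaleN1r.
rewrite scaleNr scalerBr opprB -/(v_2 u) scalerDl -addrA.
by congr (_ + _); rewrite addrC subrK.
Qed.

Let nabla1Dl x : {morph nabla1^~ x : a b / a + b}.
Proof.
move=> a b; apply: (tensor_ext nsS last_vertex2) => u.
rewrite tcoef_nabla1 [RHS](tcoefD nsS (last_vertex2 u)) !tcoef_nabla1.
rewrite !ffunE addrACA -!scalerDl.
by congr (_ *: _ + _); rewrite opprD addrACA.
Qed.

Let nabla1Dr a : {morph nabla1 a : x y / x + y}.
Proof.
move=> x y; apply: (tensor_ext nsS last_vertex2) => u.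
rewrite tcoef_nabla1 [RHS](tcoefD nsS (last_vertex2 u)) !tcoef_nabla1.
rewrite !total_spaceD [R _ (_ + _)]linearD.
by rewrite !scalerDr addrACA.
Qed.

(** The edges d_0 u and d_1 u both end at v_2, where the first term of the coefficient reads x. The
    edge d_2 u ends at v_1, where the second term reads it. *)
Let nabla1A a f x : nabla1 (Omega_act a f) x = nabla1 a (total_act f x).
Proof.
apply: (tensor_ext nsS last_vertex2) => u; rewrite !tcoef_nabla1.
rewrite !(Omega_actE nsS) !last_vertex1 !total_actE [R _ (_ *: _)]linearZ /= !scalerA.
have <- : f (v_1 u) = f (d_1 (d_0 u)) by rewrite v_1E.
by rewrite -v_2E mulrBl.
Qed.

(** With y_e the coefficient of nabla x at e, the value is y_(d_0 u) - y_(d_1 u) + R_12 y_(d_2 u),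
    and the terms in x_(v_1) and x_(v_2) cancel. *)
Lemma tcoef_curvature (u : S 2) x :
  tcoef u (v_2 u) (curvature R x) = (R_02 R u - (R_12 R u \o R_01 R u)%VF) (x (v_0 u)).
Proof.
rewrite /curvature {1}/nabla.
pose y e : total_space E := ds_incl (E := E) (x (d_0 e) - R e (x (d_1 e))).
have -> : nabla_hat R (\sum_e ftens (rho e) (y e)) = \sum_e nabla1 (rho e) (y e).
  pose hat : Omega_tensor E 1 -> Omega_tensor E 2 := nabla_hat R.
  have hatB : {morph hat : s t / s - t} := tensor_liftB nabla1Dl nabla1Dr nabla1A.
  have hat0 : hat 0 = 0 by rewrite -[0 in LHS](subrr 0) hatB subrr.
  have hatD : {morph hat : s t / s + t}.
    by move=> s t; rewrite -{1}[t]opprK -[- t]sub0r !hatB hat0 sub0r opprK.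
  rewrite -/(hat _).
  rewrite (big_morph _ hatD hat0); apply: eq_bigr => e _.
  exact: (tensor_liftE nabla1Dl nabla1Dr nabla1A).
rewrite (tcoef_sum nsS (last_vertex2 u)).
under eq_bigr do rewrite tcoef_nabla1 scalerBl.
rewrite big_split sumrB /= !(sum_delta (fun e => y e (v_2 u) : E (v_2 u))).
rewrite (sum_delta (fun e => R (d_0 u) (y e (d_1 (d_0 u))))).
rewrite {}/y (ds_incl_id (i := v_2 u)).
rewrite (ds_incl_cast (esym (v_2E u))) (ds_incl_cast (v_1E u)).
have homB (V W : vectType k) (f : 'Hom(V, W)) a b : f (a - b) = f a - f b := linearB f a b.
rewrite !homB -(total_space_cast x (esym (v_2E u))) -(total_space_cast x (v_1E u)).
rewrite add_lfunE opp_lfunE !comp_lfunE -(total_space_cast x (v_0E u)).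
rewrite /R_01 -!/(v_2 u); set r12 := R (d_0 u) _.
(* Here a = x_(v_2), b = R_12 x_(v_1), c = R_02 x_(v_0) and d = R_12 R_01 x_(v_0). *)
have zmod_id (V : zmodType) (a b c d : V) : a - b - (a - c) + (b - d) = c - d.
  by rewrite opprB [a - b + _]addrC [c - a + _]addrA subrK addrA subrK.
exact: zmod_id.
Qed.

Lemma curvature_zeroP :
  (forall u : S 2, R_02 R u = (R_12 R u \o R_01 R u)%VF) <->
  (forall u : S 2, curvature_zero_on R u).
Proof.
pose K0 u := (R_02 R u - (R_12 R u \o R_01 R u)%VF).
have K0P : curvature_components R K0.
  move=> x; apply: (tensor_ext nsS last_vertex2) => u.
  by rewrite tcoef_curvature (tcoef_sum_rho nsS (last_vertex2 u)) ds_incl_id.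
(* Testing on vectors supported at v_0 shows the components to be unique, so the existential in
   [curvature_zero_on] is about K0. *)
have K0U K : curvature_components R K -> forall u, K u = K0 u.
  move=> KP u; apply/lfunP => a; pose x : total_space E := ds_incl (E := E) a.
  move: (congr1 (tcoef u (v_2 u)) (KP x)); rewrite tcoef_curvature.
  by rewrite (tcoef_sum_rho nsS (last_vertex2 u)) !ds_incl_id.
split=> [flat u|zero u].
  by exists K0 => //; rewrite /K0 flat subrr.
by have [K /K0U-> /subr0_eq] := zero u.
Qed.

End Curvature.

(** * Isomorphisms of vector spaces *)

Section Isomorphisms.
Context {k : fieldType}.
Implicit Types U V W : vectType k.

Lemma eq_hom_trans U V W (e : U = V) (e' : V = W) :
  eq_hom (etrans e e') = (eq_hom e' \o eq_hom e)%VF.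
Proof. by case: W / e'; rewrite /= comp_lfun1l. Qed.

Lemma eq_homK V W (e : V = W) : (eq_hom (esym e) \o eq_hom e)%VF = \1%VF.
Proof. by case: W / e; rewrite /= comp_lfun1l. Qed.

Lemma eq_homVK V W (e : V = W) : (eq_hom e \o eq_hom (esym e))%VF = \1%VF.
Proof. by case: W / e; rewrite /= comp_lfun1l. Qed.

Lemma is_iso_eq_hom V W (e : V = W) : is_iso (eq_hom e).
Proof. by exists (eq_hom (esym e)); rewrite eq_homK eq_homVK. Qed.

(** In general [f^-1] is only a generalized inverse. Injectivity makes it a left inverse, and a left
    inverse of f equals the two-sided inverse g. *)
Lemma is_iso_inv V W (f : 'Hom(V, W)) : is_iso f ->
  (f^-1 \o f = \1)%VF /\ (f \o f^-1 = \1)%VF.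
Proof.
case=> g [gf fg].
have ker_f : lker f == 0%VS.
  by apply/lker0P => x y /(congr1 g); rewrite -!comp_lfunE gf !id_lfunE.
have fVf := lker0_compVf ker_f.
have eq_inv : f^-1%VF = g by rewrite -[LHS]comp_lfun1r -fg comp_lfunA fVf comp_lfun1l.
by rewrite eq_inv gf fg.
Qed.

Lemma inv_lfun1 V : (\1^-1 = \1 :> 'End(V))%VF.
Proof. by case: (is_iso_inv (is_iso_eq_hom (erefl V))) => /=; rewrite comp_lfun1r. Qed.

Lemma is_iso_comp U V W (f : 'Hom(V, W)) (g : 'Hom(U, V)) :
  is_iso f -> is_iso g -> is_iso (f \o g)%VF.
Proof.
case=> f' [f'f ff'] [g' [g'g gg']]; exists (g' \o f')%VF; split.
  by rewrite comp_lfunA -(comp_lfunA g') f'f comp_lfun1r g'g.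
by rewrite comp_lfunA -(comp_lfunA f) gg' comp_lfun1r ff'.
Qed.

Lemma is_isoV V W (f : 'Hom(V, W)) : is_iso f -> is_iso (f^-1)%VF.
Proof. by case/is_iso_inv=> fVf ffV; exists f. Qed.

Lemma iso_injl U V W (f : 'Hom(V, W)) (a b : 'Hom(U, V)) :
  is_iso f -> (f \o a = f \o b)%VF -> a = b.
Proof.
case=> g [gf _] eq_ab.
by rewrite -[a]comp_lfun1l -[b]comp_lfun1l -gf -!comp_lfunA eq_ab.
Qed.

Lemma iso_injr U V W (f : 'Hom(U, V)) (a b : 'Hom(V, W)) :
  is_iso f -> (a \o f = b \o f)%VF -> a = b.
Proof.
case=> g [_ fg] eq_ab.
by rewrite -[a]comp_lfun1r -[b]comp_lfun1r -fg !comp_lfunA eq_ab.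
Qed.

End Isomorphisms.

(** * From flat edge transports to a connection sheaf *)

Section Transport.
Context {k : fieldType} {n : nat} {S : semisimplicial n}.
Hypothesis nsS : nonsingular S.
Variables (E : S 0 -> vectType k) (R : forall e : S 1, 'Hom(E (d_1 e), E (d_0 e))).

(** A relation rather than a function, so that maps whose endpoints agree only up to a provable
    equality can be compared by uniqueness. *)
Definition transport (v w : S 0) (f : 'Hom(E v, E w)) : Prop :=
  (exists vw : v = w, f = eq_hom (congr1 E vw)) \/
  (exists e (ev : d_1 e = v) (ew : d_0 e = w),
     f = (eq_hom (congr1 E ew) \o R e \o eq_hom (congr1 E (esym ev)))%VF).

Lemma transport_edge (e : S 1) : transport (R e).
Proof. by right; exists e, erefl, erefl; rewrite /= comp_lfun1r comp_lfun1l. Qed.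

Lemma edge_ends_inj (e e' : S 1) : d_1 e = d_1 e' -> d_0 e = d_0 e' -> e = e'.
Proof. by move=> e1 e0; apply: (vertices_determine nsS); rewrite !vertices1 e1 e0. Qed.

Lemma edge_ends_neq (e : S 1) : d_1 e <> d_0 e.
Proof.
by move=> e10; have := vertices_distinct nsS e; rewrite vertices1 e10 /= inE eqxx.
Qed.

(** No edge is a loop, so the two kinds of transport exclude each other, and an edge is determined
    by its ends. *)
Lemma transport_unique v w (f g : 'Hom(E v, E w)) :
  transport f -> transport g -> f = g.
Proof.
case=> [[vw ->]|[e [ev [ew ->]]]] [[vw' ->]|[e' [ev' [ew' ->]]]].
- exact: eq_hom_inj.
- by case: (@edge_ends_neq e'); rewrite ev' ew'.
- by case: (@edge_ends_neq e); rewrite ev ew.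
have ee' : e' = e by apply: edge_ends_inj; rewrite ?ev ?ew.
subst e'.
by congr (_ \o _ \o _)%VF; apply: eq_hom_inj.
Qed.

Lemma transport_refl v (f : 'Hom(E v, E v)) : transport f -> f = \1%VF.
Proof. by move=> tf; apply: transport_unique tf _; left; exists erefl. Qed.

Lemma transport_iso v w (f : 'Hom(E v, E w)) :
  (forall e, is_iso (R e)) -> transport f -> is_iso f.
Proof.
move=> isoR [[vw ->]|[e [ev [ew ->]]]]; first exact: is_iso_eq_hom.
by do 2?[apply: is_iso_comp => //]; exact: is_iso_eq_hom.
Qed.

Lemma transport_R_01 (s : S 2) : transport (R_01 R s).
Proof. exact: transport_edge. Qed.

Lemma transport_R_12 (s : S 2) : transport (R_12 R s).
Proof.
right; exists (d_0 s), (esym (v_1E s)), erefl; rewrite /= comp_lfun1l.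
by congr (_ \o _)%VF; apply: eq_hom_inj.
Qed.

Lemma transport_R_02 (s : S 2) : transport (R_02 R s).
Proof.
right; exists (d_1 s), (esym (v_0E s)), (esym (v_2E s)).
by congr (_ \o _ \o _)%VF; apply: eq_hom_inj.
Qed.

Hypothesis flat : forall s : S 2, R_02 R s = (R_12 R s \o R_01 R s)%VF.

Lemma transport_triangle (s : S 2) (f : 'Hom(E (v_0 s), E (v_1 s)))
    (g : 'Hom(E (v_1 s), E (v_2 s))) (h : 'Hom(E (v_0 s), E (v_2 s))) :
  transport f -> transport g -> transport h -> h = (g \o f)%VF.
Proof.
move=> tf tg th; rewrite (transport_unique tf (transport_R_01 s)).
rewrite (transport_unique tg (transport_R_12 s)) -flat.
exact: transport_unique th (transport_R_02 s).
Qed.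

(** If consecutive last vertices coincide, one factor is the identity. Otherwise the three last
    vertices span a 2-simplex, where flatness applies. *)
Lemma transport_last_comp (x y z : face_poset S) (xy : (x <= y)%O) (yz : (y <= z)%O)
    (f : 'Hom(E (last_vertex (tagged x)), E (last_vertex (tagged y))))
    (g : 'Hom(E (last_vertex (tagged y)), E (last_vertex (tagged z))))
    (h : 'Hom(E (last_vertex (tagged x)), E (last_vertex (tagged z)))) :
  transport f -> transport g -> transport h -> h = (g \o f)%VF.
Proof.
have [exy|nexy] := eqVneq (last_vertex (tagged x)) (last_vertex (tagged y)).
  case: (last_vertex (tagged x)) / (esym exy) f h => f h tf tg th.
  by rewrite (transport_refl tf) comp_lfun1r; apply: transport_unique th tg.
have [eyz|neyz] := eqVneq (last_vertex (tagged y)) (last_vertex (tagged z)).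
  case: (last_vertex (tagged z)) / eyz g h => g h tf tg th.
  by rewrite (transport_refl tg) comp_lfun1l; apply: transport_unique th tf.
have /triangle_of_vertices[s [ex ey ez]] :
    subseq [:: last_vertex (tagged x); last_vertex (tagged y); last_vertex (tagged z)]
           (vertices (tagged z)).
  apply: (@subseq_last_cons _ (last_vertex (tagged x))) => //; last exact: last_vertexE.
  exact: subseq_trans (last_vertices_subseq xy nexy) (subseq_vertices yz).
case: _ / ex f h; case: _ / ey g; case: _ / ez => g f h.
exact: transport_triangle.
Qed.

Lemma transport_last (x y : face_poset S) : (x <= y)%O ->
  exists f : 'Hom(E (last_vertex (tagged x)), E (last_vertex (tagged y))), transport f.
Proof.
case/last_vertex_edge=> [xy|[e [ex ey _]]].
  by exists (eq_hom (congr1 E xy)); left; exists xy.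
by case: _ / ex; case: _ / ey; exists (R e); apply: transport_edge.
Qed.

Hypothesis isoR : forall e, is_iso (R e).

Lemma flat_extension :
  exists (F : connection_sheaf k S) (FE : vertex_spaces E F), edge_transports R FE.
Proof.
pose fob (x : face_poset S) := E (last_vertex (tagged x)).
(* The choice is harmless: transports with given endpoints are unique, and this also yields
   functoriality. *)
pose fmp x y (xy : (x <= y)%O) : 'Hom(fob x, fob y) := sval (cid (transport_last xy)).
have fmpP x y xy : transport (fmp x y xy) by rewrite /fmp; case: cid.
have fmp_id x xx : fmp x x xx = \1%VF by exact/transport_refl/fmpP.
have fmp_comp x y z (xy : (x <= y)%O) (yz : (y <= z)%O) (xz : (x <= z)%O) :
    fmp _ _ xz = (fmp _ _ yz \o fmp _ _ xy)%VF.
  by apply: transport_last_comp.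
pose F := @ConnectionSheaf _ _ _ (VectFunctor fmp_id fmp_comp)
            (fun x y xy => transport_iso isoR (fmpP x y xy)).
exists F, (fun=> erefl) => e; rewrite /= comp_lfun1l comp_lfun1r.
move: (fmpP _ _ (d_0_le e)) (fmpP _ _ (d_1_le e)).
move: (fmp _ _ (d_0_le e)) (fmp _ _ (d_1_le e)); rewrite /fob /=.
(* Since e ends at d_0 e, F(d_0 e <= e) is the identity, and F(d_1 e <= e) is R_e by uniqueness. *)
case: _ / (esym (last_vertex1 e : face S ord0 e = _)) => f g /transport_refl-> tg.
by rewrite inv_lfun1 comp_lfun1l; apply: transport_unique (transport_edge e) tg.
Qed.

End Transport.

(** * From a connection sheaf to flat edge transports *)

Section Extension.
Context {k : fieldType} {n : nat} {S : semisimplicial n}.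
Variables (E : S 0 -> vectType k) (F : connection_sheaf k S) (FE : vertex_spaces E F).

(** The formula of [edge_transports] with the edge replaced by any simplex x containing v and w. *)
Definition sheaf_transport (x : face_poset S) (v w : S 0)
    (vx : (simp v <= x)%O) (wx : (simp w <= x)%O) : 'Hom(E v, E w) :=
  (eq_hom (FE w) \o ((fmap F wx)^-1 \o fmap F vx) \o eq_hom (esym (FE v)))%VF.

Lemma fmapVK (x y : face_poset S) (xy : (x <= y)%O) :
  ((fmap F xy)^-1 \o fmap F xy)%VF = \1%VF.
Proof. by case: (is_iso_inv (sheaf_iso F xy)). Qed.

Lemma fmapKV (x y : face_poset S) (xy : (x <= y)%O) :
  (fmap F xy \o (fmap F xy)^-1)%VF = \1%VF.
Proof. by case: (is_iso_inv (sheaf_iso F xy)). Qed.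

(** Both maps into F(y) factor through the isomorphism F(x <= y), which cancels. *)
Lemma sheaf_transport_le (x y : face_poset S) (xy : (x <= y)%O) v w
    (vx : (simp v <= x)%O) (wx : (simp w <= x)%O)
    (vy : (simp v <= y)%O) (wy : (simp w <= y)%O) :
  sheaf_transport vx wx = sheaf_transport vy wy.
Proof.
congr (_ \o _ \o _)%VF; apply: (iso_injl (sheaf_iso F wy)).
rewrite [RHS]comp_lfunA fmapKV comp_lfun1l (fmap_comp F wx xy) -comp_lfunA.
by rewrite (comp_lfunA (fmap F wx)) fmapKV comp_lfun1l -fmap_comp.
Qed.

Lemma sheaf_transport_refl (x : face_poset S) v (vx vx' : (simp v <= x)%O) :
  sheaf_transport vx vx' = \1%VF.
Proof.
rewrite /sheaf_transport (bool_irrelevance vx' vx) fmapVK comp_lfun1r.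
exact: eq_homVK.
Qed.

Lemma sheaf_transport_comp (x : face_poset S) u v w
    (ux : (simp u <= x)%O) (vx : (simp v <= x)%O) (wx : (simp w <= x)%O) :
  (sheaf_transport vx wx \o sheaf_transport ux vx)%VF = sheaf_transport ux wx.
Proof.
rewrite /sheaf_transport !comp_lfunA.
rewrite -(comp_lfunA _ (eq_hom (esym (FE v)))) eq_homK comp_lfun1r.
by rewrite -(comp_lfunA _ (fmap F vx)) fmapKV comp_lfun1r.
Qed.

Lemma sheaf_transport_castr (x : face_poset S) v w w' (e : w = w')
    (vx : (simp v <= x)%O) (wx : (simp w <= x)%O) (wx' : (simp w' <= x)%O) :
  (eq_hom (congr1 E e) \o sheaf_transport vx wx)%VF = sheaf_transport vx wx'.
Proof.
by case: w' / e wx' => wx'; rewrite (bool_irrelevance wx' wx) /= comp_lfun1l.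
Qed.

Lemma sheaf_transport_castl (x : face_poset S) v v' w (e : v' = v)
    (vx : (simp v <= x)%O) (vx' : (simp v' <= x)%O) (wx : (simp w <= x)%O) :
  (sheaf_transport vx wx \o eq_hom (congr1 E e))%VF = sheaf_transport vx' wx.
Proof.
by case: v / e vx => vx; rewrite (bool_irrelevance vx' vx) /= comp_lfun1r.
Qed.

Variable R : forall e : S 1, 'Hom(E (d_1 e), E (d_0 e)).
Hypothesis FR : edge_transports R FE.

Lemma sheaf_transport_edge (x : face_poset S) (e : S 1) (ex : (simp e <= x)%O)
    (vx : (simp (d_1 e) <= x)%O) (wx : (simp (d_0 e) <= x)%O) :
  R e = sheaf_transport vx wx.
Proof. by rewrite FR; apply: sheaf_transport_le. Qed.

(** All three edge transports can be computed through the single space F(s), where they compose. *)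
Lemma extension_flat (s : S 2) : R_02 R s = (R_12 R s \o R_01 R s)%VF.
Proof.
have face_le2 (j : 'I_3) (i : 'I_2) : (simp (face S i (face S j s)) <= simp s)%O.
  exact: le_trans (le_face _ _) (le_face _ _).
have v0s : (simp (v_0 s) <= simp s)%O by exact: face_le2.
have v1s : (simp (v_1 s) <= simp s)%O by exact: face_le2.
have v2s : (simp (v_2 s) <= simp s)%O by exact: face_le2.
have -> : R_01 R s = sheaf_transport v0s v1s.
  exact/sheaf_transport_edge/le_face.
have -> : R_12 R s = sheaf_transport v1s v2s.
  rewrite /R_12 (sheaf_transport_edge (le_face _ s) (face_le2 _ _) v2s).
  exact: sheaf_transport_castl.
rewrite sheaf_transport_comp /R_02.
rewrite (sheaf_transport_edge (le_face _ s) (face_le2 _ _) (face_le2 _ _)).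
by rewrite (sheaf_transport_castr _ _ _ v2s) (sheaf_transport_castl _ _ v0s).
Qed.

End Extension.

(** * Uniqueness up to cellular gauge *)

Section Uniqueness.
Context {k : fieldType} {n : nat} {S : semisimplicial n}.
Variables (E : S 0 -> vectType k) (R : forall e : S 1, 'Hom(E (d_1 e), E (d_0 e))).
Variables (F F' : connection_sheaf k S).
Variables (FE : vertex_spaces E F) (FE' : vertex_spaces E F').
Hypotheses (FR : edge_transports R FE) (FR' : edge_transports R FE').

(** The two last vertices coincide, or an edge e of y joins them and both sides are R_e. *)
Lemma sheaf_transport_eq (x y : face_poset S) (xy : (x <= y)%O)
    (vy : (simp (last_vertex (tagged x)) <= y)%O)
    (wy : (simp (last_vertex (tagged y)) <= y)%O) :
  sheaf_transport FE vy wy = sheaf_transport FE' vy wy.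
Proof.
case: (last_vertex_edge xy) => [e|[e [ev ew ey]]].
  by case: _ / e wy => wy; rewrite !sheaf_transport_refl.
case: _ / ev vy => vy; case: _ / ew wy => wy.
by rewrite -(sheaf_transport_edge FR ey) -(sheaf_transport_edge FR' ey).
Qed.

Lemma extension_unique : exists h : nat_iso F F', cellular_gauge FE FE' h.
Proof.
have last_le (x : face_poset S) : (simp (last_vertex (tagged x)) <= x)%O.
  by case: x => p s; exact: last_vertex_le.
pose c v := eq_hom (etrans (FE v) (esym (FE' v))).
pose h x := (fmap F' (last_le x) \o c _ \o (fmap F (last_le x))^-1)%VF.
have h_iso x : is_iso (h x).
  apply: is_iso_comp; last exact/is_isoV/sheaf_iso.
  by apply: is_iso_comp; [exact: sheaf_iso|exact: is_iso_eq_hom].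
have h_nat x y (xy : (x <= y)%O) : (h y \o fmap F xy = fmap F' xy \o h x)%VF.
  have vy := le_trans (last_le x) xy.
  (* Precomposing with F(w <= x), w the last vertex of x, turns naturality into a comparison of
     transports inside y. *)
  apply: (iso_injr (sheaf_iso F (last_le x))).
  rewrite -!comp_lfunA fmapVK comp_lfun1r -fmap_comp (comp_lfunA (fmap F' xy)) -fmap_comp.
  have eqT := sheaf_transport_eq xy vy (last_le y).
  rewrite /sheaf_transport -!comp_lfunA in eqT.
  have -> : (c _ \o ((fmap F (last_le y))^-1 \o fmap F vy)
             = (fmap F' (last_le y))^-1 \o fmap F' vy \o c _)%VF.
    apply: (iso_injr (is_iso_eq_hom (esym (FE _)))).
    rewrite /c !eq_hom_trans -!comp_lfunA eq_homVK comp_lfun1r eqT.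
    by rewrite comp_lfunA eq_homK comp_lfun1l.
  by rewrite !comp_lfunA fmapKV comp_lfun1l.
exists (NatIso h_iso h_nat) => v /=; rewrite /h /=.
(* A vertex is its own last vertex, so only the cast c_v remains of h_v. *)
have -> : fmap F' (last_le (simp v)) = \1%VF := fmap_id F' _.
have -> : fmap F (last_le (simp v)) = \1%VF := fmap_id F _.
by rewrite inv_lfun1 comp_lfun1l comp_lfun1r.
Qed.

End Uniqueness.

Theorem proposition6p7 (k : fieldType) (char_k : 2%N \notin [pchar k])
    (n : nat) (S : semisimplicial n) (nsS : nonsingular S)
    (E : S 0%N -> vectType k)
    (R : forall e : S 1%N, 'Hom(E (d_1 e), E (d_0 e)))
    (isoR : forall e : S 1%N, is_iso (R e)) :
  [/\ (* (i) <-> (ii) *)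
      (forall s : S 2%N, R_02 R s = (R_12 R s \o R_01 R s)%VF) <->
        (forall s : S 2%N, curvature_zero_on R s),
      (* (i) <-> (iii) *)
      (forall s : S 2%N, R_02 R s = (R_12 R s \o R_01 R s)%VF) <->
        (exists (F : connection_sheaf k S) (FE : vertex_spaces E F), edge_transports R FE)
    & (* uniqueness of the extension up to cellular gauge *)
      forall (F F' : connection_sheaf k S)
             (FE : vertex_spaces E F) (FE' : vertex_spaces E F'),
        edge_transports R FE -> edge_transports R FE' ->
        exists h : nat_iso F F', cellular_gauge FE FE' h].
Proof.
split; first exact: curvature_zeroP.
  split=> [flat|[F [FE FR]] s]; first exact: flat_extension.
  exact: extension_flat FR s.
by move=> F F' FE FE' FR FR'; apply: extension_unique FR FR'.
Qed.
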